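(* If $D$ is a $\mathsf{WO}$-dilator, then so is its Bachmann-Howard derivative $\vartheta D$ (i.e., $\vartheta D(X)$ is a well order for every well order $X$).
   Context: $\mathsf{LO}$ is the category of linear orders with order embeddings as morphisms. For a set $X$, $[X]^{<\omega}$ is the set of finite subsets of $X$, and for $f:X\to Y$ we put $[f]^{<\omega}(a)=\{f(x)\mid x\in a\}$; this is an endofunctor of sets (forgetful functors from orders to sets are omitted). An $\mathsf{LO}$-dilator consists of a functor $D:\mathsf{LO}\to\mathsf{LO}$ and a natural transformation $\operatorname{supp}^D:D\Rightarrow[\cdot]^{<\omega}$ such that, for any $\mathsf{LO}$-morphism $f:X\to Y$ and any $\sigma\in D(Y)$, $\operatorname{supp}^D_Y(\sigma)\subseteq\operatorname{rng}(f)$ implies $\sigma\in\operatorname{rng}(D(f))$ ($\operatorname{rng}$ denotes the image). A $\mathsf{WO}$-dilator is an $\mathsf{LO}$-dilator $D$ such that $D(X)$ is well founded for any well order $X$. A Bachmann-Howard fixed point of $D$ over a linear order $X$ consists of a linear order $Z$ and functions $\iota:X\to Z$ and $\vartheta:D(Z)\to Z$ such that: (1) $\iota$ is an order embedding; (2) $\iota(x)<_Z\vartheta(\sigma)$ for all $x\in X$ and $\sigma\in D(Z)$; (3) if $\sigma<_{D(Z)}\tau$ and $z<_Z\vartheta(\tau)$ for all $z\in\operatorname{supp}^D_Z(\sigma)$, then $\vartheta(\sigma)<_Z\vartheta(\tau)$; furthermore, $z<_Z\vartheta(\sigma)$ holds for any $z\in\operatorname{supp}^D_Z(\sigma)$.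 (The function $\vartheta$ need not be an order embedding.) It is initial if for any Bachmann-Howard fixed point $(Z',\iota',\vartheta')$ of $D$ over $X$ there is a unique order embedding $f:Z\to Z'$ with $f\circ\iota=\iota'$ and $f\circ\vartheta=\vartheta'\circ D(f)$. A Bachmann-Howard derivative of an $\mathsf{LO}$-dilator $D$ consists of an $\mathsf{LO}$-dilator $\vartheta D$ and families of functions $\iota_X:X\to\vartheta D(X)$ and $\vartheta_X:D(\vartheta D(X))\to\vartheta D(X)$, indexed by linear orders $X$, such that $(\vartheta D(X),\iota_X,\vartheta_X)$ is an initial Bachmann-Howard fixed point of $D$ over $X$ for each linear order $X$, and such that for any order embedding $f:X\to Y$ of linear orders we have $\vartheta D(f)\circ\iota_X=\iota_Y\circ f$ and $\vartheta D(f)\circ\vartheta_X=\vartheta_Y\circ D(\vartheta D(f))$. Every $\mathsf{LO}$-dilator has a Bachmann-Howard derivative, which is unique up to natural isomorphism. *)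

(* Defs.v *)
From mathcomp Require Import all_boot all_order.
From mathcomp Require Import finmap.
From mathcomp Require Import boolp classical_sets.

Set Implicit Arguments.
Unset Strict Implicit.
Unset Printing Implicit Defensive.

Import Order.TTheory.

Local Open Scope order_scope.

(* Linear orders are objects of [orderType d], for an arbitrary display [d],
   which is a notational tag without mathematical content. Classically every
   linear order on a type carries such a structure, and since the morphisms
   only see the order, the extra data (choice operator, lattice operations) is
   irrelevant up to isomorphism. *)

Record embedding d (X Y : orderType d) := Embedding {
  emb_fun :> X -> Y;
  emb_mono : {mono emb_fun : x y / x <= y} }.

Definition emb_id d (X : orderType d) : embedding X X :=
  @Embedding d X X id (fun _ _ => erefl).

Definition emb_comp d (X Y Z : orderType d)
    (g : embedding Y Z) (f : embedding X Y) : embedding X Z :=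
  @Embedding d X Z (g \o f)
    (fun x y => etrans (emb_mono g (f x) (f y)) (emb_mono f x y)).

(* [{fset X}] is the set of finite subsets of [X], and [f @` a] on it is the
   image of a finite set; [range f] and inclusion are those of [set X]. *)
Record LO_dilator d := LODilator {
  dil_obj :> orderType d -> orderType d;
  dil_map : forall X Y : orderType d,
    embedding X Y -> embedding (dil_obj X) (dil_obj Y);
  dil_map_id : forall X : orderType d, dil_map (emb_id X) =1 id;
  dil_map_comp : forall (X Y Z : orderType d)
      (g : embedding Y Z) (f : embedding X Y),
    dil_map (emb_comp g f) =1 dil_map g \o dil_map f;
  dil_supp : forall X : orderType d, dil_obj X -> {fset X};
  dil_supp_nat : forall (X Y : orderType d) (f : embedding X Y)
      (s : dil_obj X),
    dil_supp (dil_map f s) = (f @` dil_supp s)%fset;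
  dil_supp_range : forall (X Y : orderType d) (f : embedding X Y)
      (s : dil_obj Y),
    ([set` dil_supp s] `<=` range f)%classic -> range (dil_map f) s }.

Arguments dil_map {d} _ {X Y} f.
Arguments dil_supp {d} _ {X} s.

Definition well_order d (X : orderType d) : Prop :=
  well_founded (fun x y : X => x < y).

Definition WO_dilator d (D : LO_dilator d) : Prop :=
  forall X : orderType d, well_order X -> well_order (D X).

Record BH_fixed_point d (D : LO_dilator d) (X Z : orderType d)
    (iota : X -> Z) (theta : D Z -> Z) : Prop := BHFixedPoint {
  BH_iota_mono : {mono iota : x y / x <= y};
  BH_iota_theta : forall (x : X) (s : D Z), iota x < theta s;
  BH_theta_lt : forall s t : D Z,
    s < t -> (forall z : Z, z \in dil_supp D s -> z < theta t) ->
    theta s < theta t;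
  BH_supp_theta : forall (s : D Z) (z : Z),
    z \in dil_supp D s -> z < theta s }.

Definition BH_morphism d (D : LO_dilator d) (X Z Z' : orderType d)
    (iota : X -> Z) (theta : D Z -> Z)
    (iota' : X -> Z') (theta' : D Z' -> Z') (f : embedding Z Z') : Prop :=
  f \o iota =1 iota' /\ f \o theta =1 theta' \o dil_map D f.

Definition initial_BH_fixed_point d (D : LO_dilator d) (X Z : orderType d)
    (iota : X -> Z) (theta : D Z -> Z) : Prop :=
  BH_fixed_point iota theta /\
  forall (Z' : orderType d) (iota' : X -> Z') (theta' : D Z' -> Z'),
    BH_fixed_point iota' theta' ->
    exists f : embedding Z Z',
      BH_morphism iota theta iota' theta' f /\
      forall g : embedding Z Z',
        BH_morphism iota theta iota' theta' g -> g =1 f.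

Record BH_derivative d (D : LO_dilator d) := BHDerivative {
  BH_dil :> LO_dilator d;
  BH_iota : forall X : orderType d, X -> BH_dil X;
  BH_theta : forall X : orderType d, D (BH_dil X) -> BH_dil X;
  BH_initial : forall X : orderType d,
    initial_BH_fixed_point (@BH_iota X) (@BH_theta X);
  BH_iota_nat : forall (X Y : orderType d) (f : embedding X Y),
    dil_map BH_dil f \o @BH_iota X =1 @BH_iota Y \o f;
  BH_theta_nat : forall (X Y : orderType d) (f : embedding X Y),
    dil_map BH_dil f \o @BH_theta X =1
    @BH_theta Y \o dil_map D (dil_map BH_dil f) }.

(* Main.v *)
Require Import Defs.
From mathcomp Require Import all_boot all_order.
From HB Require Import structures.
From mathcomp Require Import finmap.
From mathcomp Require Import boolp classical_sets.

(** Let [Z] be the initial Bachmann-Howard fixed point over a well order [X].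
    Initiality gives an induction principle: a subset of [Z] closed under
    [iota] and [theta] carries a fixed point, so [Z] maps into it, and composing
    with the inclusion yields the identity by uniqueness. Now let [W] be the
    well-founded part of [Z]. It is a well order, hence so is [D W], and one
    shows by induction on [s] in [D W] that [theta s] is in [W]: given
    [theta t < theta s], the support of [t] is in [W] by the induction
    principle, so [t] comes from [D W]. If [t < s], the induction hypothesis
    applies; if [s < t], some element of the support of [s] bounds [theta t]
    because the hypothesis of clause (3) must fail. Hence [W] is closed, so it
    is all of [Z]. *)

Set Implicit Arguments.
Unset Strict Implicit.
Unset Printing Implicit Defensive.

Import Order.TTheory.

Local Open Scope order_scope.

Section Suborder.
Context (d : Order.disp_t) (Z : orderType d) (P : Z -> Prop).

Definition suborder : Type := {z : Z | `[< P z >]}.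

HB.instance Definition _ := SubChoice.on suborder.
HB.instance Definition _ := [SubChoice_isSubOrder of suborder by <: with d].

Definition in_suborder (z : Z) (Pz : P z) : suborder :=
  exist _ z (asboolT Pz).

Lemma suborderP (w : suborder) : P (val w).
Proof. exact: asboolW (valP w). Qed.

Lemma val_suborder_mono : {mono (val : suborder -> Z) : x y / x <= y}.
Proof. by move=> x y; rewrite Order.le_val. Qed.

Definition suborder_emb : embedding suborder Z :=
  Embedding val_suborder_mono.

Lemma suborder_wf :
  (forall z, P z -> Acc (fun x y : Z => x < y) z) -> well_order suborder.
Proof.
move=> accP w; have := accP _ (suborderP w).
(* The induction runs on accessibility in [Z], so [val w] becomes a free [z] while [w] stays
   general. *)
move: {-1}(val w) (erefl (val w)) => z zE acc_z.
elim: acc_z w zE => {}z _ IH w zE; constructor=> v ltvw.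
by apply: (IH (val v)) => //; rewrite -zE (leW_mono val_suborder_mono).
Qed.

Variable D : LO_dilator d.

Lemma dil_supp_suborder (s : D suborder) (z : Z) :
  z \in dil_supp D (dil_map D suborder_emb s) -> P z.
Proof.
by rewrite dil_supp_nat => /imfsetP [w _ ->]; exact: suborderP.
Qed.

(** The inclusion has range [P], so the support condition of [D] applies to it. *)
Lemma dil_suborder_lift (t : D Z) :
  (forall z, z \in dil_supp D t -> P z) ->
  exists s : D suborder, dil_map D suborder_emb s = t.
Proof.
move=> Pt; have [|s _ <-] := dil_supp_range (f := suborder_emb) (s := t).
  by move=> z /= /Pt Pz; exists (in_suborder Pz).
by exists s.
Qed.

End Suborder.

Lemma emb_lt d (X Y : orderType d) (f : embedding X Y) :
  {mono f : x y / x < y}.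
Proof. exact: leW_mono (emb_mono f). Qed.

Section InitialFixedPoint.
Context (d : Order.disp_t) (D : LO_dilator d) (X Z : orderType d).
Context (iota : X -> Z) (theta : D Z -> Z).
Hypothesis Zinit : initial_BH_fixed_point iota theta.

Let Zfix : BH_fixed_point iota theta := Zinit.1.

Lemma initial_BH_ind (P : Z -> Prop) :
  (forall x, P (iota x)) ->
  (forall s, (forall z, z \in dil_supp D s -> P z) -> P (theta s)) ->
  forall z, P z.
Proof.
move=> Piota Ptheta; pose j := suborder_emb P.
pose iotaP x : suborder P := in_suborder (Piota x).
pose thetaP (s : D (suborder P)) : suborder P :=
  in_suborder (Ptheta _ (@dil_supp_suborder _ _ _ _ s)).
have fixP : BH_fixed_point iotaP thetaP.
  split.
  - by move=> x y; rewrite -(emb_mono j); exact: (BH_iota_mono Zfix).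
  - by move=> x s; rewrite -(emb_lt j); exact: (BH_iota_theta Zfix).
  - move=> s t ltst supp_lt; rewrite -(emb_lt j).
    apply: (BH_theta_lt Zfix); first by rewrite emb_lt.
    move=> z; rewrite dil_supp_nat => /imfsetP [w /= ws ->].
    by have := supp_lt w ws; rewrite -(emb_lt j).
  - move=> s z zs; rewrite -(emb_lt j); apply: (BH_supp_theta Zfix).
    by rewrite dil_supp_nat; apply/imfsetP; exists z.
have [f [[f_iota f_theta] _]] := Zinit.2 _ _ _ fixP.
have [h [_ h_uniq]] := Zinit.2 _ _ _ Zfix.
have jfh : emb_comp j f =1 h.
  apply: h_uniq; split=> [x|s] /=.
    by have /= -> := f_iota x.
  by have /= -> := f_theta s; rewrite /= dil_map_comp.
have idh : emb_id Z =1 h.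
  by apply: h_uniq; split=> [//|s] /=; rewrite dil_map_id.
(* Thus [z] equals [j (f z)], a value of the inclusion. *)
by move=> z; rewrite -[z]/(emb_id Z z) idh -jfh; exact: suborderP.
Qed.

Hypotheses (Dwo : WO_dilator D) (Xwo : well_order X).

Let acc : Z -> Prop := Acc (fun x y : Z => x < y).

(** By clause (2) no [theta s] lies below [iota x], so only [iota y] with [y < x] can. *)
Lemma acc_iota (x : X) : acc (iota x).
Proof.
elim/(well_founded_ind Xwo): x => x IH; constructor.
apply: initial_BH_ind => [y|s _].
  by rewrite (leW_mono (BH_iota_mono Zfix)); exact: IH.
by rewrite ltNge (ltW (BH_iota_theta Zfix x s)).
Qed.

(** Stated over [D (suborder acc)], since [Dwo] makes this order well founded. *)
Lemma acc_theta (s : D (suborder acc)) :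
  acc (theta (dil_map D (suborder_emb acc) s)).
Proof.
elim/(well_founded_ind (Dwo (suborder_wf (P := acc) (fun _ => id)))): s => s IH.
(* The inner induction is on the elements below [theta s]; the support of [t] stays below that bound
   by transitivity. *)
constructor; apply: initial_BH_ind => [x _|t IHt lt_ts]; first exact: acc_iota.
have [r rE] : exists r, dil_map D (suborder_emb acc) r = t.
  apply: dil_suborder_lift => z zt; apply: IHt => //.
  exact: lt_trans (BH_supp_theta Zfix zt) lt_ts.
subst t; case: (ltgtP r s) => [ltrs|ltsr|eqrs].
- exact: IH.
(* If [small] held, clause (3) would contradict [lt_ts]; otherwise [theta r] is at most some [z] in
   the support of [s], and [z] is accessible. *)
- have [small|] := pselect (forall z, z \in
      dil_supp D (dil_map D (suborder_emb acc) s) ->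
      z < theta (dil_map D (suborder_emb acc) r)).
    have lt_st := BH_theta_lt Zfix (etrans (emb_lt _ s r) ltsr) small.
    by have := lt_trans lt_st lt_ts; rewrite ltxx.
  move=> /existsNP [z /not_implyP [zs /negP]]; rewrite -leNgt le_eqVlt.
  have acc_z : acc z := dil_supp_suborder zs.
  by case/predU1P=> [->|]; [exact: acc_z | exact: (Acc_inv acc_z)].
- by rewrite eqrs ltxx in lt_ts.
Qed.

Lemma initial_BH_well_order : well_order Z.
Proof.
apply: initial_BH_ind => [|s acc_s]; first exact: acc_iota.
by have [r <-] := dil_suborder_lift acc_s; exact: acc_theta.
Qed.

End InitialFixedPoint.

Theorem corollary4p3 (d : Order.disp_t) (D : LO_dilator d)
    (vD : BH_derivative D) :
  WO_dilator D -> WO_dilator vD.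
Proof.
by move=> Dwo X Xwo; exact: initial_BH_well_order (BH_initial vD X) Dwo Xwo.
Qed.
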